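(* Let $\mathfrak{L}$ be an algebra over $\mathbb{C}$ all of whose $\frac{1}{2}$-derivations are trivial. Then every local $\frac{1}{2}$-derivation of $\mathfrak{L}$ and every $2$-local $\frac{1}{2}$-derivation of $\mathfrak{L}$ is a trivial $\frac{1}{2}$-derivation.
   Context: An algebra is a complex vector space $\mathfrak{L}$ with a bilinear multiplication $[-,-]$ (no identities are assumed). A linear map $D:\mathfrak{L}\to\mathfrak{L}$ is a $\frac12$-derivation if $D[x,y]=\frac12\big([D(x),y]+[x,D(y)]\big)$ for all $x,y\in\mathfrak{L}$. A $\frac12$-derivation is trivial if it has the form $D(x)=\lambda x$ for all $x\in\mathfrak{L}$, for some fixed $\lambda\in\mathbb{C}$. A linear map $\Delta:\mathfrak{L}\to\mathfrak{L}$ is a local $\frac12$-derivation if for every $x\in\mathfrak{L}$ there is a $\frac12$-derivation $D_x$ (depending on $x$) with $\Delta(x)=D_x(x)$. A map $\nabla:\mathfrak{L}\to\mathfrak{L}$ (not necessarily linear) is a $2$-local $\frac12$-derivation if for all $x,y\in\mathfrak{L}$ there is a $\frac12$-derivation $D_{x,y}$ with $\nabla(x)=D_{x,y}(x)$ and $\nabla(y)=D_{x,y}(y)$. *)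

(* Defs.v *)
From mathcomp Require Import all_boot all_order all_algebra.
From mathcomp Require Import reals complex.

Set Implicit Arguments.
Unset Strict Implicit.
Unset Printing Implicit Defensive.

Import GRing.Theory.
Local Open Scope ring_scope.

(* The complex numbers are R[i] for an arbitrary R : realType.  An algebra is a
   complex vector space L, of arbitrary dimension, together with a bilinear
   map mul : L -> L -> L satisfying no further identity. *)

Definition half_derivation (R : realType) (L : lmodType R[i])
    (mul : {bilinear L -> L -> L}) (D : L -> L) : Prop :=
  linear D /\
  forall x y : L, D (mul x y) = (2 : R[i])^-1 *: (mul (D x) y + mul x (D y)).

Definition trivial_half_derivation (R : realType) (L : lmodType R[i])
    (mul : {bilinear L -> L -> L}) (D : L -> L) : Prop :=
  half_derivation mul D /\
  exists lambda : R[i], forall x : L, D x = lambda *: x.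

Definition local_half_derivation (R : realType) (L : lmodType R[i])
    (mul : {bilinear L -> L -> L}) (Delta : L -> L) : Prop :=
  linear Delta /\
  forall x : L, exists D : L -> L, half_derivation mul D /\ Delta x = D x.

Definition two_local_half_derivation (R : realType) (L : lmodType R[i])
    (mul : {bilinear L -> L -> L}) (nabla : L -> L) : Prop :=
  forall x y : L, exists D : L -> L,
    [/\ half_derivation mul D, nabla x = D x & nabla y = D y].

(* Main.v *)
Require Import Defs.
From mathcomp Require Import all_boot all_order all_algebra.
From mathcomp Require Import reals complex boolp.

(** Triviality of the half-derivations means that a local or 2-local
    half-derivation only sees homotheties.  A 2-local one therefore acts on any
    two given vectors by a common scalar; testing every vector against one fixed
    nonzero vector, whose scalar is unique, makes the scalar global
    ([scalar_of_pairwise_scalar]).  A local one is a linear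
    map for which every vector is an eigenvector, and by linearity the
    eigenvalues of two vectors can be chosen equal
    ([pairwise_scalar_of_pointwise_scalar]), which reduces this case to the
    previous one.  Finally, homotheties are half-derivations because the
    multiplication is bilinear. *)

Import GRing.Theory.
Local Open Scope ring_scope.

(** All vectors take their scalar from one fixed nonzero vector, which
    determines it; if there is no such vector, any scalar will do. *)
Lemma scalar_of_pairwise_scalar (F : fieldType) (V : lmodType F) (f : V -> V) :
  (forall x y, exists2 c : F, f x = c *: x & f y = c *: y) ->
  exists c : F, forall x, f x = c *: x.
Proof.
move=> f_pair.
have [[v v_neq0]|all0] := EM (exists v : V, v != 0).
  have [c fv _] := f_pair v v.
  exists c => x; have [d fx] := f_pair x v.
  rewrite fv fx => /eqP; rewrite -subr_eq0 -scalerBl scaler_eq0 (negPf v_neq0).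
  by rewrite orbF subr_eq0 => /eqP ->.
exists 0 => x; have [d -> _] := f_pair x x.
have -> : x = 0 by apply/eqP/negPn/negP => x_neq0; apply: all0; exists x.
by rewrite !scaler0.
Qed.

(** Let [a], [b], [c] be eigenvalues of [x], [y], [x + y].  Additivity gives
    [(a - c) x = (c - b) y].  Either [c = b], and then [a = b] unless [x = 0];
    or [y] is a multiple of [x], and then [a] is an eigenvalue of [y]. *)
Lemma pairwise_scalar_of_pointwise_scalar
    (F : fieldType) (V : lmodType F) (f : V -> V) :
  linear f -> (forall x, exists c : F, f x = c *: x) ->
  forall x y, exists2 c : F, f x = c *: x & f y = c *: y.
Proof.
move=> f_lin f_eig x y.
have [a fx] := f_eig x; have [b fy] := f_eig y; have [c fxy] := f_eig (x + y).
have [x0|x_neq0] := eqVneq x 0.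
  by exists b => //; rewrite fx x0 !scaler0.
exists a => //.
have add_eq : (a - c) *: x = (c - b) *: y.
  have := f_lin 1 x y; rewrite !scale1r fxy fx fy scalerDr => cE.
  apply/eqP; rewrite !scalerBl subr_eq addrAC eq_sym subr_eq addrC.
  exact/eqP.
have [cb|cb] := eqVneq (c - b) 0.
  move/eqP: add_eq; rewrite cb scale0r scaler_eq0 (negPf x_neq0) orbF subr_eq0.
  by rewrite fy; move/subr0_eq: cb => <- /eqP ->.
have f0 : f 0 = 0 by have [d ->] := f_eig 0; rewrite scaler0.
have -> : y = ((c - b)^-1 * (a - c)) *: x.
  by rewrite -scalerA add_eq scalerA mulVf // scale1r.
by rewrite -[X in f X]addr0 f_lin f0 addr0 fx !scalerA mulrC.
Qed.

Lemma trivial_half_derivation_of_scalar (R : realType) (L : lmodType R[i])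
    (mul : {bilinear L -> L -> L}) (D : L -> L) :
  (exists c : R[i], forall x, D x = c *: x) -> trivial_half_derivation mul D.
Proof.
move=> [c Dc]; split; last by exists c.
split=> [k x y|x y]; rewrite !Dc.
  by rewrite scalerDr !scalerA mulrC.
rewrite linearZl_LR linearZr_LR; set v := c *: _.
rewrite -mulr2n -(scaler_nat 2 v) scalerA mulVf ?scale1r //.
by rewrite Num.Theory.pnatr_eq0.
Qed.

Theorem theorem4 (R : realType) (L : lmodType R[i])
    (mul : {bilinear L -> L -> L})
    (Htriv : forall D : L -> L,
        half_derivation mul D -> trivial_half_derivation mul D) :
  (forall Delta : L -> L,
      local_half_derivation mul Delta -> trivial_half_derivation mul Delta) /\
  (forall nabla : L -> L,
      two_local_half_derivation mul nabla -> trivial_half_derivation mul nabla).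
Proof.
split=> [Delta [Delta_lin Delta_loc]|nabla nabla_loc];
  apply/trivial_half_derivation_of_scalar/scalar_of_pairwise_scalar.
  apply: pairwise_scalar_of_pointwise_scalar => // x.
  have [D [/Htriv[_ [c Dc]] ->]] := Delta_loc x.
  by exists c.
move=> x y; have [D [/Htriv[_ [c Dc]] -> ->]] := nabla_loc x y.
by exists c.
Qed.
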